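(* Assume that there is no $k\in\mathbb{Q}\setminus\{0\}$ such that $f_k(z)=\frac{z^4+1}{kz^3}$ has a $\mathbb{Q}$-rational periodic point of minimal period at least $3$. Then the possible $\mathbb{Q}$-rational preperiodic graphs of $f_k$ for $k\in\mathbb{Q}\setminus\{0\}$ are the following. $G_1$: $\infty$ is fixed and $0\to\infty$ (total $2$ points); for all $k$ not in the families $G_2,G_3,G_4$. $G_2$: $\infty$ is fixed, $0\to\infty$, and there are two further fixed points (total $4$ points); for $k=1+t^4$, $t\in\mathbb{Q}\setminus\{0\}$. $G_3$: $\infty$ is fixed, $0\to\infty$, and there is one $2$-cycle (total $4$ points); for $k=-(1+t^4)$, $t\in\mathbb{Q}\setminus\{0\}$. $G_4$: $\infty$ is fixed, $0\to\infty$, and there are two $2$-cycles (total $6$ points); for $k=\pm(t^2+t^{-2})$, $t\in\mathbb{Q}\setminus\{0,\pm1\}$.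
   Context: The $\mathbb{Q}$-rational preperiodic graph of $f$ is the directed graph whose vertices are the $\mathbb{Q}$-rational preperiodic points of $f$ in $\mathbb{P}^1(\mathbb{Q})$, with an edge $P\to f(P)$ for each vertex; in the descriptions all vertices and edges are listed. *)

(* Defs.v *)
From mathcomp Require Import all_boot all_order all_algebra.

Set Implicit Arguments.
Unset Strict Implicit.
Unset Printing Implicit Defensive.

Import GRing.Theory.
Local Open Scope ring_scope.

(* P^1(Q) as Q together with the point at infinity [None]. *)
Definition P1Q := option rat.
Definition infty : P1Q := None.
Definition affine (z : rat) : P1Q := Some z.

(* The self-map of P^1(Q) defined by p/q, for coprime p and q.  With
   d = deg (p/q) = max (deg p, deg q), the value at infinity is the ratio of
   the coefficients of degree d (the homogenized forms evaluated at [1 : 0]). *)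
Definition ratmap (p q : {poly rat}) (P : P1Q) : P1Q :=
  let proj (a b : rat) := if b == 0 then infty else affine (a / b) in
  match P with
  | Some z => proj p.[z] q.[z]
  | None => let d := (maxn (size p) (size q)).-1 in proj p`_d q`_d
  end.

Definition f (k : rat) : P1Q -> P1Q := ratmap ('X^4 + 1) (k *: 'X^3).

Definition preperiodic (T : Type) (g : T -> T) (x : T) : Prop :=
  exists m n : nat, (0 < n)%N /\ iter (m + n) g x = iter m g x.

Definition has_minimal_period (T : Type) (g : T -> T) (n : nat) (x : T) : Prop :=
  [/\ (0 < n)%N, iter n g x = x &
      forall m : nat, (0 < m < n)%N -> iter m g x <> x].

Record digraph := Digraph {
  vertex : Type;
  edge : vertex -> vertex -> Prop
}.

Definition digraph_iso (G H : digraph) (phi : vertex G -> vertex H) : Prop :=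
  bijective phi /\ forall u v, edge u v <-> edge (phi u) (phi v).

Definition preper_graph (g : P1Q -> P1Q) : digraph :=
  @Digraph {P : P1Q | preperiodic g P} (fun u v => sval v = g (sval u)).

(* The digraph on {0, ..., size s - 1} whose edges are i -> s_i. *)
Definition succ_graph (s : seq nat) : digraph :=
  @Digraph 'I_(size s) (fun i j => nat_of_ord j = nth 0%N s i).

(* Vertices 0 and 1 stand for the points infinity and 0 of P^1(Q). *)
Definition G1 : seq nat := [:: 0; 0]%N.
Definition G2 : seq nat := [:: 0; 0; 2; 3]%N.
Definition G3 : seq nat := [:: 0; 0; 3; 2]%N.
Definition G4 : seq nat := [:: 0; 0; 3; 2; 5; 4]%N.

(* Isomorphism of digraphs respecting the labels infinity and 0. *)
Definition has_preper_graph (g : P1Q -> P1Q) (s : seq nat) : Prop :=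
  exists phi : vertex (succ_graph s) -> vertex (preper_graph g),
    [/\ digraph_iso phi,
        forall i : 'I_(size s), i = 0%N :> nat -> sval (phi i) = infty &
        forall i : 'I_(size s), i = 1%N :> nat -> sval (phi i) = affine 0].

Definition family2 (k : rat) : Prop :=
  exists t : rat, t != 0 /\ k = 1 + t ^+ 4.

Definition family3 (k : rat) : Prop :=
  exists t : rat, t != 0 /\ k = - (1 + t ^+ 4).

Definition family4 (k : rat) : Prop :=
  exists t : rat, [/\ t != 0, t != 1, t != -1 &
    k = t ^+ 2 + t ^- 2 \/ k = - (t ^+ 2 + t ^- 2)].

(* Main.v *)
(* f_k is injective on Q \ {0}: if f_k z = f_k w with z <> w, then z / w = p / q
   is positive and pq (p^2 + pq + q^2) is a fourth power.  The factors pq and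
   p^2 + pq + q^2 are coprime, hence fourth powers u^4 and v^4, and
   u^4 + v^4 = (p + q)^2 contradicts Fermat.  As 0 is not a value of f_k, every
   preperiodic point other than 0 and infinity is thus periodic, of period at
   most 2 by assumption, and the equations of the points of period 1 and 2 can
   be solved explicitly: f_k z is z, - z, 1 / z or - 1 / z.  Fermat's theorem on
   x^4 - y^4 = z^2 shows that the family of G_2 is disjoint from the other ones. *)

Require Import Defs.
From mathcomp Require Import all_boot all_order all_algebra.
From mathcomp Require Import zify ring lra.
From Stdlib Require Import ProofIrrelevance.
Import Order.TTheory GRing.Theory Num.Theory.

(** * Coprime factors of powers, Pythagorean triples, Fermat's quartic equations *)

(** The root is [gcdn a c]: its power is gcd(a^(k+1), c^(k+1)) = gcd(a a^k, a b) = a gcd(a^k, b) =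
    a. *)
Lemma coprime_mul_expn (k a b c : nat) :
  coprime a b -> (a * b = c ^ k.+1)%N -> exists u, a = (u ^ k.+1)%N.
Proof.
move=> cab abc; exists (gcdn a c).
have expn_gcd m n : (gcdn m n ^ k.+1 = gcdn (m ^ k.+1) (n ^ k.+1))%N.
  have [->|m_gt0] := posnP m; first by rewrite exp0n // !gcd0n.
  have g_gt0 : (0 < gcdn m n)%N by rewrite gcdn_gt0 m_gt0.
  have cop : coprime (m %/ gcdn m n) (n %/ gcdn m n).
    rewrite /coprime -(eqn_pmul2r g_gt0) muln_gcdl mul1n.
    by rewrite !divnK ?dvdn_gcdl ?dvdn_gcdr.
  rewrite -[in RHS](divnK (dvdn_gcdl m n)) -[X in gcdn _ (X ^ _)](divnK (dvdn_gcdr m n)).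
  rewrite !expnMn -muln_gcdl; move: cop.
  by rewrite -(coprime_pexpl _ _ (ltn0Sn k)) -(coprime_pexpr _ _ (ltn0Sn k))
    => /eqP ->; rewrite mul1n.
rewrite expn_gcd -abc expnS -muln_gcdr.
have /eqP-> : coprime (a ^ k) b by rewrite coprimeXl.
by rewrite muln1.
Qed.

Lemma coprime_by_primes (a b : nat) :
  (0 < a)%N -> (forall p, prime p -> p %| a -> p %| b -> False) -> coprime a b.
Proof.
move=> a_gt0 noP; rewrite /coprime; have [//|g1] := eqVneq (gcdn a b) 1%N.
have pg : prime (pdiv (gcdn a b)).
  by rewrite pdiv_prime // ltn_neqAle eq_sym g1 gcdn_gt0 a_gt0.
by case: (noP _ pg); apply: dvdn_trans (pdiv_dvd _) _; rewrite ?dvdn_gcdl ?dvdn_gcdr.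
Qed.

Lemma coprime_prime_dvd (a b p : nat) :
  coprime a b -> prime p -> p %| a -> p %| b -> False.
Proof.
move=> cab pp pa pb; have : p %| gcdn a b by rewrite dvdn_gcd pa.
by rewrite (eqP cab) dvdn1 => /eqP p1; rewrite p1 in pp.
Qed.

(** The numbers v = (z + x)/2 and u = (z - x)/2 are coprime with product (y/2)^2, hence are squares
    m^2 and n^2. The equation for [x] is additive because subtraction on [nat] truncates. *)
Lemma primitive_pythagorean (x y z : nat) :
  (0 < y)%N -> coprime x y -> odd x -> ~~ odd y -> (x ^ 2 + y ^ 2 = z ^ 2)%N ->
  exists m n, [/\ (0 < n)%N, coprime m n, odd (m + n) &
    [/\ x + n ^ 2 = m ^ 2, y = 2 * (m * n) & z = m ^ 2 + n ^ 2]%N].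
Proof.
move=> y_gt0 cxy ox ey e.
have x_gt0 := odd_gt0 ox.
have oz : odd z.
  have : odd (z ^ 2) by rewrite -e oddD !oddX /= ox (negbTE ey).
  by rewrite oddX.
have [h yh] : exists h, y = (2 * h)%N by exists (y %/ 2)%N; lia.
have xz : (x < z)%N by rewrite -(ltn_exp2r _ _ (isT : 0 < 2)%N) -e -addn1 leq_add2l
  expn_gt0 y_gt0.
have [u zu] : exists u, z = (x + 2 * u)%N by exists ((z - x) %/ 2)%N; lia.
set v := (x + u)%N.
have vu : (v * u = h ^ 2)%N by rewrite /v; nia.
have cvu : coprime v u.
  apply: coprime_by_primes; first by rewrite addn_gt0 x_gt0.
  move=> p pp pv pu.
  have px : p %| x by rewrite /v dvdn_addl in pv.
  have ph : p %| h by have : p %| h ^ 2 by [rewrite -vu dvdn_mulr];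
    rewrite Euclid_dvdX // => /andP[].
  by apply: (coprime_prime_dvd _ _ _ cxy pp px); rewrite yh dvdn_mull.
have [m vm] := coprime_mul_expn 1 _ _ _ cvu vu.
rewrite coprime_sym in cvu; rewrite mulnC in vu.
have [n un] := coprime_mul_expn 1 _ _ _ cvu vu.
exists m, n.
have hmn : (h ^ 2 = (m * n) ^ 2)%N by rewrite -vu un vm expnMn mulnC.
have {}hmn : (h = m * n)%N by apply/eqP; rewrite -(eqn_exp2r _ _ (isT : 0 < 2)%N) hmn.
have n_gt0 : (0 < n)%N by case: n hmn {un} => // hmn; rewrite yh hmn muln0 in y_gt0.
split=> //.
- by move: cvu; rewrite un vm coprime_pexpl ?coprime_pexpr // coprime_sym.
- have : odd (v + u) by rewrite /v; lia.
  by rewrite un vm !oddD !oddX.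
split; lia.
Qed.

(* Descent: x^2 + p^2 = m^2 and m (p / 2) = (y / 2)^2 with p / 2 = a b, so that
   a = c^2, b = d^2 and m = e1^2 with c^4 + d^4 = e1^2. *)
Lemma fermat_add4 (x y z : nat) :
  (0 < x)%N -> (0 < y)%N -> coprime x y -> (x ^ 4 + y ^ 4 <> z ^ 2)%N.
Proof.
have [n] := ubnP z; elim: n => // n IHn in x y z *.
wlog ey : x y / ~~ odd y => [WL|] zn x_gt0 y_gt0 cxy e.
  have [oy|ey] := boolP (odd y); last exact: (WL x y).
  have [ox|ex] := boolP (odd x); last first.
    by apply: (WL y x) => //; rewrite 1?coprime_sym // addnC.
  (* If both are odd, the sum of the fourth powers is 2 modulo 4, not a square. For x = 2q + 1 the
     witness is q(q + 1). *)
  have [a xa] : exists a, (x ^ 2 = 4 * a + 1)%N by exists (((x %/ 2) * (x %/ 2).+1))%N; nia.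
  have [b yb] : exists b, (y ^ 2 = 4 * b + 1)%N by exists (((y %/ 2) * (y %/ 2).+1))%N; nia.
  have e4 u : (u ^ 4 = (u ^ 2) ^ 2)%N by rewrite -expnM.
  move: e; rewrite !e4 xa yb => e.
  have [oz|ez] := boolP (odd z).
    have : odd (z ^ 2) by rewrite oddX.
    by rewrite -e oddD !oddX !oddD; case: (odd a); case: (odd b).
  have [c zc] : exists c, (z = 2 * c)%N by exists (z %/ 2)%N; lia.
  by rewrite zc in e; clear -e; nia.
have ox : odd x.
  case: (boolP (odd x)) => // ex.
  have : 2 %| gcdn x y by rewrite dvdn_gcd !dvdn2 ex ey.
  by rewrite (eqP cxy).
have [|||||m [p [p_gt0 cmp omp [xmp ymp zmp]]]] := @primitive_pythagorean (x ^ 2) (y ^ 2) z.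
- by rewrite expn_gt0 y_gt0.
- by rewrite coprimeXl ?coprimeXr.
- by rewrite oddX.
- by rewrite oddX.
- by rewrite -!expnM.
(* An odd [p] would make [m] even and x^2 = m^2 - p^2 congruent to 3 modulo 4. So [p] is the even
   leg of the second triple. *)
have ep : ~~ odd p.
  apply/negP => op.
  have [a xa] : exists a, (x ^ 2 = 4 * a + 1)%N by exists (((x %/ 2) * (x %/ 2).+1))%N; nia.
  have em : ~~ odd m by move: omp; rewrite oddD op addbT.
  have [c mc] : exists c, (m = 2 * c)%N by exists (m %/ 2)%N; lia.
  have [b yb] : exists b, (p ^ 2 = 4 * b + 1)%N by exists (((p %/ 2) * (p %/ 2).+1))%N; nia.
  by rewrite mc in xmp; nia.
have cxp : coprime x p.
  apply: coprime_by_primes => // q qp qx qp'.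
  apply: (coprime_prime_dvd _ _ _ cmp qp) => //.
  have : q %| m ^ 2 by rewrite -xmp dvdn_add // Euclid_dvdX ?qx ?qp'.
  by rewrite Euclid_dvdX // => /andP[].
have [|||||a [b [b_gt0 cab oab [xab pab mab]]]] := @primitive_pythagorean x p m => //.
have [h yh] : exists h, y = (2 * h)%N by exists (y %/ 2)%N; lia.
have hm : (m * (a * b) = h ^ 2)%N by clear -ymp pab yh; nia.
have a_gt0 : (0 < a)%N by case: a pab {cab oab xab mab hm} => // pab; rewrite pab in p_gt0.
have m_gt0 : (0 < m)%N by rewrite mab addn_gt0 !expn_gt0 b_gt0 orbT.
have cmab : coprime m (a * b).
  apply: coprime_by_primes => // q qp qm qab.
  apply: (coprime_prime_dvd _ _ _ cmp qp) => //.
  by rewrite pab dvdn_mull.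
have [e1 me] := coprime_mul_expn 1 _ _ _ cmab hm.
have [h1 abh] : exists h1, (a * b = h1 ^ 2)%N.
  by rewrite coprime_sym in cmab; rewrite mulnC in hm; exact: coprime_mul_expn hm.
have [c ac] := coprime_mul_expn 1 _ _ _ cab abh.
have [d bd] : exists d, (b = d ^ 2)%N.
  by rewrite coprime_sym in cab; rewrite mulnC in abh; exact: coprime_mul_expn abh.
apply: (IHn c d e1).
(* The descent is strict: e1 <= m <= m^2 < m^2 + p^2 = z. *)
- have p2 : (0 < p ^ 2)%N by rewrite expn_gt0 p_gt0.
  have e1m : (e1 <= m)%N by rewrite me -[X in (X <= _)%N]expn1 leq_pexp2l //;
    case: e1 me m_gt0 => // ->.
  have mm : (m <= m ^ 2)%N by rewrite -[X in (X <= _)%N]expn1 leq_pexp2l.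
  by clear -zn zmp p2 e1m mm; lia.
- by case: c ac a_gt0 => [-> //|].
- by case: d bd b_gt0 => [-> //|].
- by move: cab; rewrite ac bd coprime_pexpl ?coprime_pexpr.
- by rewrite -me mab ac bd -!expnM.
Qed.

(* Descent: if y is odd then x^2 = m^2 + p^2 and y^2 = m^2 - p^2, whence
   p^4 + (x y)^2 = m^4; if y is even then (y / 2)^2 = a b (a^2 - b^2) with
   coprime factors c^2, d^2 and e1^2, whence d^4 + e1^2 = c^4. *)
Lemma fermat_sub4 (x y z : nat) :
  (0 < y)%N -> (0 < z)%N -> coprime x y -> (y ^ 4 + z ^ 2 <> x ^ 4)%N.
Proof.
have [n] := ubnP x; elim: n => // n IHn in x y z *.
move=> xn y_gt0 z_gt0 cxy e.
have cyz : coprime (y ^ 2) z.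
  apply: coprime_by_primes; first by rewrite expn_gt0 y_gt0.
  move=> p pp; rewrite Euclid_dvdX // => /andP[py _] pz.
  have : p %| x ^ 4 by rewrite -e dvdn_add // Euclid_dvdX ?py ?pz.
  by rewrite Euclid_dvdX // => /andP[px _]; apply: coprime_prime_dvd cxy pp px py.
have e2 : ((y ^ 2) ^ 2 + z ^ 2 = (x ^ 2) ^ 2)%N by rewrite -!expnM.
have [oy|ey] := boolP (odd y).
  have ez : ~~ odd z.
    (* With [y] and [z] odd, y^4 + z^2 would be 2 modulo 4, not a square. *)
    apply/negP => oz; case: (boolP (odd (x ^ 2))) => ox2.
      have : odd ((x ^ 2) ^ 2) by rewrite oddX ox2.
      by rewrite -e2 oddD !oddX oy oz.
    have [a ya] : exists a, (y ^ 2 = 2 * a + 1)%N by exists ((y ^ 2) %/ 2)%N;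
      have : odd (y ^ 2) by [rewrite oddX oy]; lia.
    have [b zb] : exists b, (z = 2 * b + 1)%N by exists (z %/ 2)%N; lia.
    have [c xc] : exists c, (x ^ 2 = 2 * c)%N by exists ((x ^ 2) %/ 2)%N; lia.
    by rewrite ya zb xc in e2; clear -e2; nia.
  have [|||||m [p [p_gt0 cmp omp [ymp zmp xmp]]]] :=
    @primitive_pythagorean (y ^ 2) z (x ^ 2) => //.
    by rewrite oddX oy.
  have mp : (p < m)%N.
    by rewrite -(ltn_exp2r _ _ (isT : 0 < 2)%N) -ymp -[X in (X < _)%N]add0n ltn_add2r
      expn_gt0 y_gt0.
  have mx : (m < x)%N.
    by rewrite -(ltn_exp2r _ _ (isT : 0 < 2)%N) xmp -[X in (X < _)%N]addn0 ltn_add2l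
      expn_gt0 p_gt0.
  apply: (IHn m p (x * y)%N) => //.
  - by apply: leq_trans mx _.
  - by rewrite muln_gt0 y_gt0 andbT; case: x mx {e xn cxy e2 xmp}.
  - have -> : ((x * y) ^ 2 = y ^ 2 * x ^ 2)%N by rewrite expnMn mulnC.
    by rewrite xmp; clear -ymp; nia.
have ox : odd x.
  case: (boolP (odd x)) => // ex.
  by case: (coprime_prime_dvd _ _ 2 cxy); rewrite ?dvdn2.
have oz : odd z.
  have : odd (x ^ 4) by rewrite oddX ox.
  by rewrite -e oddD !oddX /= (negbTE ey).
have [|||||m [p [p_gt0 cmp omp [zmp ymp xmp]]]] :=
  @primitive_pythagorean z (y ^ 2) (x ^ 2) => //.
- by rewrite expn_gt0 y_gt0.
- by rewrite coprime_sym.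
- by rewrite oddX.
- by rewrite addnC.
have mp : (p < m)%N.
  by rewrite -(ltn_exp2r _ _ (isT : 0 < 2)%N) -zmp -[X in (X < _)%N]add0n ltn_add2r.
(* [m] and [p] have opposite parity; [m'] names the odd one and [p'] the even one, as the triple
   with hypotenuse [x] requires. *)
have [m' [p' [p'_gt0 m'_gt0 cmp' [om' ep' xmp' ymp']]]] :
    exists m' p', [/\ 0 < p', 0 < m', coprime m' p' &
   [/\ odd m', ~~ odd p', x ^ 2 = m' ^ 2 + p' ^ 2 & y ^ 2 = 2 * (m' * p')]]%N.
  have m_gt0 : (0 < m)%N by apply: leq_trans mp.
  have [om|em] := boolP (odd m).
    by exists m, p; split=> //; split=> //; move: omp; rewrite oddD om.
  exists p, m; split=> //; first by rewrite coprime_sym.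
  split=> //; first by move: omp; rewrite oddD (negbTE em).
    by rewrite addnC.
  by rewrite ymp (mulnC m).
have [|||||a [b [b_gt0 cab oab [mab pab xab]]]] := @primitive_pythagorean m' p' x => //.
have [h yh] : exists h, y = (2 * h)%N by exists (y %/ 2)%N; lia.
have ba : (b < a)%N.
  by rewrite -(ltn_exp2r _ _ (isT : 0 < 2)%N) -mab -[X in (X < _)%N]add0n ltn_add2r.
have a_gt0 : (0 < a)%N by apply: leq_trans ba.
have hm : (m' * (a * b) = h ^ 2)%N by clear -ymp' pab yh; nia.
have cmab : coprime m' (a * b).
  apply: coprime_by_primes => // q qp qm qab.
  apply: (coprime_prime_dvd _ _ _ cmp' qp) => //.
  by rewrite pab dvdn_mull.
have [e1 me] := coprime_mul_expn 1 _ _ _ cmab hm.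
have [h1 abh] : exists h1, (a * b = h1 ^ 2)%N.
  by rewrite coprime_sym in cmab; rewrite mulnC in hm; exact: coprime_mul_expn hm.
have [c ac] := coprime_mul_expn 1 _ _ _ cab abh.
have [d bd] : exists d, (b = d ^ 2)%N.
  by rewrite coprime_sym in cab; rewrite mulnC in abh; exact: coprime_mul_expn abh.
(* The descent is strict: c <= a <= a^2 < a^2 + b^2 = x. *)
have cx : (c < x)%N.
  have b2 : (0 < b ^ 2)%N by rewrite expn_gt0 b_gt0.
  have c1m : (c <= a)%N by rewrite ac -[X in (X <= _)%N]expn1 leq_pexp2l //;
    case: c ac a_gt0 => // ->.
  have mm : (a <= a ^ 2)%N by rewrite -[X in (X <= _)%N]expn1 leq_pexp2l.
  by clear -xab b2 c1m mm; lia.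
apply: (IHn c d e1).
- by apply: leq_trans cx _.
- by case: d bd b_gt0 => [-> //|].
- by case: e1 me m'_gt0 => [-> //|].
- by move: cab; rewrite ac bd coprime_pexpl ?coprime_pexpr.
- have -> : (d ^ 4 = b ^ 2)%N by rewrite bd -expnM.
  have -> : (c ^ 4 = a ^ 2)%N by rewrite ac -expnM.
  by rewrite -me addnC.
Qed.

Local Open Scope ring_scope.
Local Arguments f : simpl never.

(** * From Fermat's equations to statements about rationals *)

Lemma rat_frac_nat (x : rat) : 0 < x ->
  exists p q : nat, [/\ (0 < p)%N, (0 < q)%N, coprime p q & x = p%:R / q%:R].
Proof.
move=> x_gt0; exists `|numq x|%N, `|denq x|%N; split.
- by rewrite absz_gt0 numq_eq0 gt_eqF.
- by rewrite absz_gt0 denq_neq0.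
- exact: coprime_num_den.
- have nn : 0 <= numq x by rewrite numq_ge0 ltW.
  by rewrite -[LHS]divq_num_den !natr_absz !ger0_norm ?denq_ge0.
Qed.

(** If p^(k+1) = N q^(k+1), then [q] divides [p], so the root is integral. This carries rational
    squares and fourth powers to [nat], where Fermat's theorems apply. *)
Lemma rat_root_nat (k N : nat) (x : rat) :
  0 < x -> x ^+ k.+1 = N%:R -> exists c, N = (c ^ k.+1)%N.
Proof.
move=> /rat_frac_nat[p [q [p_gt0 q_gt0 cpq ->]]] e.
have q0 : (q%:R : rat) != 0 by rewrite pnatr_eq0 -lt0n.
have {}e : (p ^ k.+1 = N * q ^ k.+1)%N.
  apply/eqP; rewrite -(eqr_nat rat) natrM !natrX -e expr_div_n divfK //.
  by rewrite expf_eq0 (negbTE q0) andbF.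
have : (q ^ k.+1 %| p ^ k.+1)%N by rewrite e dvdn_mull.
rewrite dvdn_pexp2r // => /dvdnP[c pc]; exists c.
apply/eqP; rewrite -(@eqn_pmul2r (q ^ k.+1)%N) ?expn_gt0 ?q_gt0 //.
by rewrite -e pc expnMn.
Qed.

Lemma cube_quotient_inj (z w : rat) : z != 0 -> w != 0 ->
  (z ^+ 4 + 1) * w ^+ 3 = (w ^+ 4 + 1) * z ^+ 3 -> z = w.
Proof.
move=> z0 w0 e; apply/eqP; apply/negPn/negP => zw.
(* The cofactor of z - w in the difference of the two sides must vanish. *)
have {}e : (z * w) ^+ 3 = z ^+ 2 + z * w + w ^+ 2.
  have : (z - w) * ((z * w) ^+ 3 - (z ^+ 2 + z * w + w ^+ 2)) == 0.
    have -> : (z - w) * ((z * w) ^+ 3 - (z ^+ 2 + z * w + w ^+ 2)) =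
      (z ^+ 4 + 1) * w ^+ 3 - (w ^+ 4 + 1) * z ^+ 3 by ring.
    by rewrite e subrr.
  by rewrite mulf_eq0 !subr_eq0 (negbTE zw) => /eqP.
(* The right side of [e] is (z + w/2)^2 + 3w^2/4, so the cube of zw is positive. *)
have zw_gt0 : 0 < z * w.
  rewrite -(@exprn_odd_gt0 _ 3) // e.
  have : 0 < w ^+ 2 by rewrite exprn_even_gt0.
  have : 0 <= (z + w / 2) ^+ 2 by rewrite sqr_ge0.
  lra.
have x_gt0 : 0 < z / w.
  by have -> : z / w = (z * w) / w ^+ 2 by [field]; rewrite divr_gt0 // exprn_even_gt0.
have [p [q [p_gt0 q_gt0 cpq zpq]]] := rat_frac_nat _ x_gt0.
have q0 : (q%:R : rat) != 0 by rewrite pnatr_eq0 -lt0n.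
have {}zpq : z = p%:R * w / q%:R by rewrite -mulrAC -zpq divfK.
(* Substituting z = pw/q in [e] and clearing denominators gives (wp)^4; the absolute value supplies
   the positive root that [rat_root_nat] expects. *)
have wp4 : `|w * p%:R| ^+ 4 = (p * q * (p ^ 2 + p * q + q ^ 2))%:R.
  rewrite -normrX ger0_norm ?exprn_even_ge0 //.
  rewrite !(natrM, natrD, natrX).
  have w2 : w ^+ 2 != 0 by rewrite expf_neq0.
  apply: (mulfI w2); rewrite zpq in e.
  transitivity (p%:R * q%:R ^+ 3 * (p%:R * w / q%:R * w) ^+ 3); first by field.
  by rewrite e; field.
have [|c Nc] := rat_root_nat 3 _ _ _ wp4.
  by rewrite normr_gt0 mulf_neq0 // pnatr_eq0 -lt0n.
have pq_gt0 : (0 < p * q)%N by rewrite muln_gt0 p_gt0.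
(* A prime dividing both numbers divides one of [p], [q], hence the square of the other. *)
have cop : coprime (p * q) (p ^ 2 + p * q + q ^ 2).
  apply: coprime_by_primes => // l ll; rewrite Euclid_dvdM // => lpq ls.
  have lpq' : (l %| p * q)%N by rewrite Euclid_dvdM.
  case/orP: lpq => lx.
    have lq : (l %| q ^ 2)%N by rewrite -(dvdn_addr _ (m := (p ^ 2 + p * q)%N)) //
      dvdn_add // dvdn_exp.
    by move: lq; rewrite Euclid_dvdX // andbT; apply: coprime_prime_dvd cpq ll lx.
  have lp : (l %| p ^ 2)%N by rewrite -(dvdn_addl _ (n := (p * q + q ^ 2)%N)) ?addnA //
    dvdn_add // dvdn_exp.
  by move: lp; rewrite Euclid_dvdX // andbT => lp; apply: coprime_prime_dvd cpq ll lp lx.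
have [u pqu] := coprime_mul_expn 3 _ _ _ cop Nc.
have [v sv] : exists v, (p ^ 2 + p * q + q ^ 2 = v ^ 4)%N.
  by rewrite coprime_sym in cop; rewrite mulnC in Nc; exact: coprime_mul_expn Nc.
have s_gt0 : (0 < p ^ 2 + p * q + q ^ 2)%N by rewrite addn_gt0 addn_gt0 pq_gt0 orbT.
apply: (@fermat_add4 u v (p + q)%N).
- by case: u pqu pq_gt0 => [->|].
- by case: v sv s_gt0 => [->|].
- by move: cop; rewrite sv pqu coprime_pexpl ?coprime_pexpr.
- by rewrite -pqu -sv; lia.
Qed.

(* [t ^ 4 - 1 = (s - 1 / s) ^ 2] contradicts Fermat unless it vanishes. *)
Lemma family_intersection (s t : rat) : s != 0 -> t != 0 ->
  1 + t ^+ 4 = s ^+ 2 + s ^- 2 -> s ^+ 2 = 1 /\ t ^+ 2 = 1.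
Proof.
move=> s0 t0 e.
have {}e : t ^+ 4 - 1 = (s - s^-1) ^+ 2.
  have -> : (s - s^-1) ^+ 2 = s ^+ 2 + s ^- 2 - 2 by field.
  by rewrite -e; ring.
have s1 : s - s^-1 = 0 -> s ^+ 2 = 1.
  by move=> h; have : s * (s - s^-1) = 0 by [rewrite h mulr0]; rewrite mulrBr divff //; lra.
(* In the degenerate case t^4 = 1, and t^2 = 1 because t^2 is nonnegative. *)
have [d0|d0] := eqVneq (s - s^-1) 0.
  split; first exact: s1.
  apply/eqP; rewrite -(@pexpr_eq1 _ _ 2) ?sqr_ge0 // -exprM -subr_eq0 e d0.
  by rewrite expr0n.
have [|m [n [m_gt0 n_gt0 cmn tmn]]] := rat_frac_nat `|t| _.
  by rewrite normr_gt0.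
have n0 : (n%:R : rat) != 0 by rewrite pnatr_eq0 -lt0n.
have t4 : t ^+ 4 = m%:R ^+ 4 / n%:R ^+ 4.
  by rewrite -expr_div_n -tmn -normrX ger0_norm // exprn_even_ge0.
have d2 : 0 < (s - s^-1) ^+ 2 by rewrite exprn_even_gt0.
(* Clearing the denominator of |t| = m/n presents m^4 - n^4 as a rational square, hence as a square
   in [nat]. *)
have e2 : (`|s - s^-1| * n%:R ^+ 2) ^+ 2 = m%:R ^+ 4 - n%:R ^+ 4.
  by rewrite exprMn -normrX ger0_norm ?sqr_ge0 // -e t4; field.
have e3 : 0 < (m%:R : rat) ^+ 4 - n%:R ^+ 4.
  by rewrite -e2 exprn_even_gt0 //= mulf_neq0 ?normr_eq0 ?expf_neq0.
have nm : (n ^ 4 <= m ^ 4)%N by rewrite ltnW // -(ltr_nat rat) !natrX -subr_gt0.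
rewrite -!natrX -natrB // in e2.
have [|c Nc] := rat_root_nat 1 _ _ _ e2.
  by apply: mulr_gt0; rewrite ?normr_gt0 // ltr0n expn_gt0 n_gt0.
case: (@fermat_sub4 m n c) => //.
  case: c Nc => // Nc.
  by move: e3; rewrite -!natrX -natrB // Nc.
by rewrite -Nc subnKC.
Qed.

(** * The map [f k] and its points of period at most 2 *)

(** The fraction has degree 4, and its denominator has no term of that degree. *)
Lemma f_infty (k : rat) : k != 0 -> f k infty = infty.
Proof.
move=> k0; rewrite /f /ratmap size_scale // size_polyXn.
have -> : size ('X^4 + 1 : {poly rat}) = 5.
  by rewrite size_polyDl ?size_polyXn // size_poly1.
by rewrite coefZ coefXn mulr0 eqxx.
Qed.

Lemma f_0 (k : rat) : f k (affine 0) = infty.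
Proof. by rewrite /f /ratmap /affine hornerZ hornerXn expr0n mulr0 eqxx. Qed.

Lemma f_affine (k z : rat) : k != 0 -> z != 0 ->
  f k (affine z) = affine ((z ^+ 4 + 1) / (k * z ^+ 3)).
Proof.
by move=> k0 z0; rewrite /f /ratmap /affine hornerZ hornerD !hornerXn hornerC mulf_eq0
  expf_eq0 /= (negbTE k0) (negbTE z0).
Qed.

Lemma f_affineP (k z w : rat) : k != 0 -> z != 0 ->
  f k (affine z) = affine w <-> z ^+ 4 + 1 = k * z ^+ 3 * w.
Proof.
move=> k0 z0; rewrite f_affine //.
have kz : k * z ^+ 3 != 0 by rewrite mulf_neq0 ?expf_neq0.
split=> [[<-]|->]; first by rewrite mulrC divfK.
by rewrite mulrAC divff // mul1r.
Qed.

(** Since z^4 + 1 is positive, orbits of nonzero rationals avoid 0 and infinity. *)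
Lemma f_affine_neq0 (k z : rat) : k != 0 -> z != 0 ->
  exists2 w, w != 0 & f k (affine z) = affine w.
Proof.
move=> k0 z0; exists ((z ^+ 4 + 1) / (k * z ^+ 3)); last exact: f_affine.
rewrite mulf_neq0 ?invr_eq0 ?mulf_neq0 ?expf_neq0 //.
by rewrite gt_eqF // ltr_wpDl // exprn_even_ge0.
Qed.

Lemma f_affine_inj (k z w : rat) : k != 0 -> z != 0 -> w != 0 ->
  f k (affine z) = f k (affine w) -> z = w.
Proof.
move=> k0 z0 w0; rewrite [in RHS]f_affine // => /f_affineP-/(_ k0 z0) e.
by apply: cube_quotient_inj => //; rewrite e; field; rewrite w0 k0.
Qed.

Lemma iter_f_affine_neq0 (k z : rat) n : k != 0 -> z != 0 ->
  exists2 w, w != 0 & iter n (f k) (affine z) = affine w.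
Proof.
move=> k0 z0; elim: n => [|n [w w0 e]]; first by exists z.
by have [v v0 ve] := f_affine_neq0 _ _ k0 w0; exists v; rewrite //= e.
Qed.

(** The orbit stays among nonzero rationals, where [f k] is injective, so the [m] steps of the tail
    can be cancelled one by one. *)
Lemma preperiodic_periodic (k z : rat) : k != 0 -> z != 0 ->
  preperiodic (f k) (affine z) ->
  exists2 n, (0 < n)%N & iter n (f k) (affine z) = affine z.
Proof.
move=> k0 z0 [m [n [n_gt0 e]]]; exists n => //.
elim: m e => //= m IHm e; apply: IHm; move: e.
have [u u0 ->] := iter_f_affine_neq0 _ _ (m + n) k0 z0.
have [v v0 ->] := iter_f_affine_neq0 _ _ m k0 z0.
by move=> /f_affine_inj->.
Qed.

Definition no_long_cycle : Prop :=
  ~ (exists (k : rat) (P : P1Q) (n : nat),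
       [/\ k != 0, (3 <= n)%N & has_minimal_period (f k) n P]).

(** The least positive return time is the minimal period; it is 1 or 2 by [no_long_cycle]. *)
Lemma preperiodic_period2 (k z : rat) :
  no_long_cycle ->
  k != 0 -> z != 0 -> preperiodic (f k) (affine z) ->
  f k (f k (affine z)) = affine z.
Proof.
move=> noper k0 z0 /preperiodic_periodic-/(_ k0 z0) [n0 n0_gt0 n0e].
have ex : exists n, (0 < n)%N && (iter n (f k) (affine z) == affine z).
  by exists n0; rewrite n0_gt0 n0e eqxx.
have [n /andP[n_gt0 /eqP ne] nmin] := ex_minnP ex.
case: n n_gt0 ne nmin => [|[|[|n]]] // _ ne nmin.
  by move: (ne : f k (affine z) = affine z) => e1; rewrite !e1.
case: noper; exists k, (affine z), n.+3; split=> //; split=> // m /andP[m_gt0 mn] me.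
by move: mn; rewrite ltnNge nmin // m_gt0 me eqxx.
Qed.

(** With w = f_k(z), subtracting the equations of z -> w and w -> z gives (z^2 - w^2)(kwz - z^2 -
    w^2) = 0. If the second factor vanishes, the first equation gives (zw)^2 = 1. The alternatives
    are thus w = z, -z, 1/z, -1/z in this order. *)
Lemma period2P (k z : rat) : k != 0 -> z != 0 ->
  f k (f k (affine z)) = affine z ->
  [\/ (k - 1) * z ^+ 4 = 1, (k + 1) * z ^+ 4 = - 1,
      k = z ^+ 2 + z ^- 2 | k = - (z ^+ 2 + z ^- 2)].
Proof.
move=> k0 z0; have [w w0 e] := f_affine_neq0 _ _ k0 z0; rewrite e.
move: e => /(f_affineP _ _ _ k0 z0) e1 /(f_affineP _ _ _ k0 w0) e2.
have : (z ^+ 2 - w ^+ 2) * (k * w * z - (z ^+ 2 + w ^+ 2)) = 0.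
  have -> : (z ^+ 2 - w ^+ 2) * (k * w * z - (z ^+ 2 + w ^+ 2)) =
     (k * z ^+ 3 * w - (z ^+ 4 + 1)) - (k * w ^+ 3 * z - (w ^+ 4 + 1)) by ring.
  by rewrite e1 e2 !subrr.
move/eqP; rewrite mulf_eq0 !subr_eq0 eqf_sqr => /orP[/orP[]|] /eqP e3.
- by constructor 1; rewrite -e3 in e1; rewrite mulrBl; lra.
- constructor 2; have we : w = - z by rewrite e3 opprK.
  by rewrite we in e1; lra.
- have : (z * w) ^+ 2 == 1.
    have : z ^+ 2 * (k * w * z) = z ^+ 4 + 1 by rewrite e1; ring.
    rewrite e3 => h; apply/eqP; lra.
  rewrite sqrf_eq1 => /orP[] /eqP zw.
    have we : w = z^-1 by apply: (mulfI z0); rewrite zw divff.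
    constructor 3; rewrite we in e3; rewrite -exprVn -e3; field.
    exact: z0.
  have we : w = - z^-1 by apply: (mulfI z0); rewrite zw mulrN divff.
  constructor 4; rewrite we in e3.
  have -> : z ^+ 2 + z ^- 2 = z ^+ 2 + (- z^-1) ^+ 2 by rewrite sqrrN exprVn.
  by rewrite -e3; field.
Qed.

(** This and the next three lemmas compute the image of [z] in each alternative of [period2P]. *)
Lemma f_fixed (k z : rat) : k != 0 -> z != 0 -> (k - 1) * z ^+ 4 = 1 ->
  f k (affine z) = affine z.
Proof. by move=> k0 z0 e; apply/f_affineP => //; lra. Qed.

Lemma f_opp (k z : rat) : k != 0 -> z != 0 -> (k + 1) * z ^+ 4 = - 1 ->
  f k (affine z) = affine (- z).
Proof. by move=> k0 z0 e; apply/f_affineP => //; lra. Qed.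

Lemma f_inv (k z : rat) : k != 0 -> z != 0 -> k = z ^+ 2 + z ^- 2 ->
  f k (affine z) = affine z^-1.
Proof. by move=> k0 z0 e; apply/f_affineP => //; rewrite e; field. Qed.

Lemma f_opp_inv (k z : rat) : k != 0 -> z != 0 -> k = - (z ^+ 2 + z ^- 2) ->
  f k (affine z) = affine (- z^-1).
Proof. by move=> k0 z0 e; apply/f_affineP => //; rewrite e; field. Qed.

(** * Building and reading preperiodic graphs *)

(** Vertices of [preper_graph] carry proofs of preperiodicity; proof irrelevance reduces their
    equality to that of points. *)
Lemma sval_inj (T : Type) (P : T -> Prop) (u v : {x | P x}) : sval u = sval v -> u = v.
Proof.
by case: u v => [x Px] [y Py] /= xy; subst y; congr exist; apply: proof_irrelevance.
Qed.

(** The test by [all] is decided by computation: the successor function s stays in range and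
    satisfies s^3 = s, so each listed point is preperiodic with tail 1 and period 2. The isomorphism
    sends an index to its point, with inverse [index]. *)
Lemma has_preper_graph_intro (g : P1Q -> P1Q) (s : seq nat) (pts : seq P1Q) :
  size pts = size s -> uniq pts ->
  nth infty pts 0 = infty -> nth infty pts 1 = affine 0 ->
  all (fun i => (nth 0 s i < size s) &&
      (nth 0 s (nth 0 s (nth 0 s i)) == nth 0 s i))%N (iota 0 (size s)) ->
  (forall i, (i < size s)%N -> g (nth infty pts i) = nth infty pts (nth 0%N s i)) ->
  (forall P, preperiodic g P -> P \in pts) ->
  has_preper_graph g s.
Proof.
move=> szp up p0 p1 /allP sP gP inP.
have sP' i : (i < size s)%N -> (nth 0 s i < size s)%N /\
    nth 0%N s (nth 0%N s (nth 0%N s i)) = nth 0%N s i.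
  by move=> ilt; have := sP i; rewrite mem_iota => /(_ ilt)/andP[? /eqP].
have preP i : (i < size s)%N -> preperiodic g (nth infty pts i).
  move=> ilt; exists 1%N, 2%N; split=> //=.
  have [lt1 e1] := sP' i ilt; have [lt2 _] := sP' _ lt1.
  by rewrite gP // gP // gP // e1.
pose phi (i : 'I_(size s)) : {P | preperiodic g P} :=
  exist _ (nth infty pts i) (preP i (ltn_ord i)).
have idxP (u : {P | preperiodic g P}) : (index (sval u) pts < size s)%N.
  by rewrite -szp index_mem; apply: inP; apply: svalP.
pose psi u : 'I_(size s) := Ordinal (idxP u).
exists phi; split=> [|i /= ->|i /= ->] //; split.
  exists psi => [i|u].
    by apply: val_inj; rewrite /= index_uniq // szp.
  by apply: sval_inj; rewrite /= nth_index //; apply: inP; apply: svalP.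
move=> u v /=; rewrite gP //; split=> [->//|e].
have [lt1 _] := sP' _ (ltn_ord u).
by apply/eqP; rewrite -(nth_uniq infty _ _ up) ?szp // e.
Qed.

Lemma has_preper_graph_elim (g : P1Q -> P1Q) (s : seq nat) :
  has_preper_graph g s -> exists pts : 'I_(size s) -> P1Q,
  [/\ injective pts,
      forall i j : 'I_(size s), nth 0%N s i = j -> g (pts i) = pts j,
      forall i : 'I_(size s), i = 0%N :> nat -> pts i = infty &
      forall i : 'I_(size s), i = 1%N :> nat -> pts i = affine 0].
Proof.
case=> phi [[bij_phi edgeP] p0 p1]; exists (fun i => sval (phi i)); split=> //.
  by move=> i j /sval_inj /(bij_inj bij_phi).
by move=> i j e; have [/(_ (esym e))] := edgeP i j.
Qed.

(** Both index sets biject with the same vertex set. The sizes 2, 4, 4, 6 then separate all the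
    graphs except [G2] from [G3]. *)
Lemma has_preper_graph_size (g : P1Q -> P1Q) (s s' : seq nat) :
  has_preper_graph g s -> has_preper_graph g s' -> size s = size s'.
Proof.
case=> phi [[bij_phi _] _ _] [phi' [[[psi K K'] _] _ _]].
have /bij_eq_card : bijective (psi \o phi).
  by apply: bij_comp bij_phi; exists phi'.
by rewrite !card_ord.
Qed.

(** * Matching points of period at most 2 with the families *)

Lemma inv_family2 (k z : rat) : z != 0 -> (k - 1) * z ^+ 4 = 1 -> k = 1 + z^-1 ^+ 4.
Proof.
move=> z0 e; have z4 : z ^+ 4 != 0 by rewrite expf_neq0.
by rewrite exprVn; apply: (mulIf z4); rewrite mulrDl mulVf // mul1r -e; ring.
Qed.

Lemma inv_family3 (k z : rat) : z != 0 -> (k + 1) * z ^+ 4 = - 1 -> k = - (1 + z^-1 ^+ 4).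
Proof.
move=> z0 e; have z4 : z ^+ 4 != 0 by rewrite expf_neq0.
rewrite exprVn; apply: (mulIf z4); rewrite mulNr mulrDl mulVf // mul1r opprD -e; ring.
Qed.

Lemma exprV4 (t : rat) : t != 0 -> t ^+ 4 * t^-1 ^+ 4 = 1.
Proof. by move=> t0; rewrite -exprMn divff // expr1n. Qed.

Lemma sqr_sqrV_gt0 (z : rat) : z != 0 -> 0 < z ^+ 2 + z ^- 2.
Proof. by move=> z0; rewrite addr_gt0 ?invr_gt0 // exprn_even_gt0. Qed.

(** Multiplying the difference of the two sides by s^2 gives (s^2 - t^2)(s^2 - t^-2). *)
Lemma sqr_sqrV_inj (s t : rat) : s != 0 -> t != 0 ->
  s ^+ 2 + s ^- 2 = t ^+ 2 + t ^- 2 ->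
  [\/ s = t, s = - t, s = t^-1 | s = - t^-1].
Proof.
move=> s0 t0 e.
have : (s ^+ 2 - t ^+ 2) * (s ^+ 2 - t^-1 ^+ 2) = 0.
  transitivity (s ^+ 2 * ((s ^+ 2 + s ^- 2) - (t ^+ 2 + t ^- 2)));
    first by field; rewrite s0 t0.
  by rewrite e subrr mulr0.
move/eqP; rewrite mulf_eq0 !subr_eq0 !eqf_sqr.
by case/orP=> /orP[] /eqP; [constructor 1|constructor 2|constructor 3|constructor 4].
Qed.

Lemma two_cycle_family (k z : rat) : k != 0 -> z != 0 ->
  f k (f k (affine z)) = affine z -> f k (affine z) <> affine z ->
  family3 k \/ family4 k.
Proof.
move=> k0 z0 /(period2P _ _ k0 z0) e nfix.
have inv3 : (k + 1) * z ^+ 4 = - 1 -> family3 k.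
  by move/(inv_family3 _ _ z0) ->; exists z^-1; rewrite invr_eq0.
case: e => [/(f_fixed _ _ k0 z0) //|/inv3|e|e]; first by left.
  right; exists z; split=> //; last by left.
    (* At z = 1 or -1 the image 1/z would be [z] itself, a fixed point. *)
    by apply/eqP => z1; apply: nfix; rewrite f_inv // z1 invr1.
  by apply/eqP => z1; apply: nfix; rewrite f_inv // z1 invrN invr1.
(* Here z = 1 or -1 is allowed: then k = -2, which lies in [family3]. *)
have [z1|z1] := eqVneq (z ^+ 2) 1.
  left; apply: inv3; have -> : z ^+ 4 = 1 by rewrite (exprM z 2 2) z1 expr1n.
  by rewrite e z1 invr1; lra.
move: z1; rewrite sqrf_eq1 negb_or => /andP[z1 z2].
by right; exists z; split=> //; right.
Qed.

Lemma fixed_family2 (k z : rat) : k != 0 -> z != 0 ->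
  f k (affine z) = affine z -> family2 k.
Proof.
move=> k0 z0 /(f_affineP _ _ _ k0 z0) e; exists z^-1; rewrite invr_eq0; split=> //.
apply: inv_family2 => //.
have : k * z ^+ 3 * z = k * z ^+ 4 by ring.
lra.
Qed.

Lemma preperiodic_in (g : P1Q -> P1Q) (pts : seq P1Q) :
  infty \in pts -> affine 0 \in pts ->
  (forall z, z != 0 -> preperiodic g (affine z) -> affine z \in pts) ->
  forall P, preperiodic g P -> P \in pts.
Proof.
move=> pi p0 pz [z|//]; have [->//|] := eqVneq z 0; exact: pz.
Qed.

Lemma sqr_eq_of_mul_pow4 (z t : rat) : t != 0 -> z ^+ 4 * t ^+ 4 = 1 -> z ^+ 2 = t^-1 ^+ 2.
Proof.
move=> t0 e; apply/eqP; rewrite -(@eqrXn2 _ 2) ?sqr_ge0 // -!exprM /=.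
by apply/eqP; rewrite exprVn -[LHS]mulr1 -(@divff _ (t ^+ 4)) ?expf_neq0 // mulrA e mul1r.
Qed.

Lemma uniq_pm (a : rat) : a != 0 -> uniq [:: infty; affine 0; affine a; affine (- a)].
Proof.
move=> a0; rewrite /= !inE !(inj_eq Some_inj) ![0 == _]eq_sym oppr_eq0 (negbTE a0) /=.
by rewrite andbT; apply/eqP => h; move/eqP: a0; apply; lra.
Qed.

Lemma uniq_pm2 (a b : rat) : a != 0 -> b != 0 -> a ^+ 2 != b ^+ 2 ->
  uniq [:: infty; affine 0; affine a; affine b; affine (- a); affine (- b)].
Proof.
move=> a0 b0; rewrite eqf_sqr negb_or => /andP[ab abN].
have aa : a != - a by apply/eqP => h; move/eqP: a0; apply; lra.
have bb : b != - b by apply/eqP => h; move/eqP: b0; apply; lra.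
rewrite /= !inE !(inj_eq Some_inj) ![0 == _]eq_sym !oppr_eq0 (negbTE a0) (negbTE b0) /=.
by rewrite eqr_opp (eq_sym b (- a)) eqr_oppLR !negb_or ab abN aa bb.
Qed.

(** * The graph attached to each family *)

Lemma preper_graph1 (k : rat) : no_long_cycle -> k != 0 ->
  ~ (family2 k \/ family3 k \/ family4 k) -> has_preper_graph (f k) G1.
Proof.
move=> noper k0 nfam; apply: (@has_preper_graph_intro _ _ [:: infty; affine 0]) => //.
  by case=> [|[|]] // _; rewrite /= ?f_infty ?f_0.
apply: preperiodic_in => // z z0 pz; case: nfam.
have e2 := preperiodic_period2 _ _ noper k0 z0 pz.
have [e1|/eqP e1] := eqVneq (f k (affine z)) (affine z).
  by left; exact: (fixed_family2 _ z).
by right; apply: (two_cycle_family _ z).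
Qed.

(** The extra fixed points are 1/t and -1/t. Signs exclude the second and fourth alternatives of
    [period2P]. *)
Lemma preper_graph2 (k : rat) : no_long_cycle -> k != 0 -> family2 k ->
  has_preper_graph (f k) G2.
Proof.
move=> noper k0 [t [t0 kt]].
have t4 : 0 < t ^+ 4 by rewrite exprn_even_gt0.
have tV0 : t^-1 != 0 by rewrite invr_eq0.
have fixV : (k - 1) * t^-1 ^+ 4 = 1 by rewrite kt -[RHS](exprV4 t t0); ring.
apply: (@has_preper_graph_intro _ _ [:: infty; affine 0; affine t^-1; affine (- t^-1)]) => //.
- exact: uniq_pm.
- case=> [|[|[|[|]]]] // _; rewrite /= ?f_infty ?f_0 // f_fixed ?oppr_eq0 //.
  by rewrite -[RHS]fixV; ring.
apply: preperiodic_in => // z z0 pz; rewrite !inE !(inj_eq Some_inj) (negbTE z0) /= -eqf_sqr.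
have z4 : 0 < z ^+ 4 by rewrite exprn_even_gt0.
have := period2P _ _ k0 z0 (preperiodic_period2 _ _ noper k0 z0 pz).
rewrite kt => -[e|e|e|e]; apply/eqP.
- by apply: sqr_eq_of_mul_pow4 => //; rewrite -[RHS]e; ring.
- by have := mulr_gt0 t4 z4; lra.
(* The families of [z] and [t] meet only at k = 2, where z^2 = t^2 = 1 and [z] is already listed. *)
- by have [-> t1] := family_intersection _ _ z0 t0 e; rewrite exprVn t1 invr1.
- by have := sqr_sqrV_gt0 _ z0; lra.
Qed.

Lemma preper_graph3 (k : rat) : no_long_cycle -> k != 0 -> family3 k ->
  has_preper_graph (f k) G3.
Proof.
move=> noper k0 [t [t0 kt]].
have t4 : 0 < t ^+ 4 by rewrite exprn_even_gt0.
have tV0 : t^-1 != 0 by rewrite invr_eq0.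
have oppV : (k + 1) * t^-1 ^+ 4 = - 1 by rewrite kt -[X in _ = - X](exprV4 t t0); ring.
apply: (@has_preper_graph_intro _ _ [:: infty; affine 0; affine t^-1; affine (- t^-1)]) => //.
- exact: uniq_pm.
- case=> [|[|[|[|]]]] // _; rewrite /= ?f_infty ?f_0 // f_opp ?oppr_eq0 ?opprK //.
  by rewrite -[RHS]oppV; ring.
apply: preperiodic_in => // z z0 pz; rewrite !inE !(inj_eq Some_inj) (negbTE z0) /= -eqf_sqr.
have z4 : 0 < z ^+ 4 by rewrite exprn_even_gt0.
have := period2P _ _ k0 z0 (preperiodic_period2 _ _ noper k0 z0 pz).
rewrite kt => -[e|e|e|e]; apply/eqP.
- by have := mulr_gt0 t4 z4; lra.
- by apply: sqr_eq_of_mul_pow4 => //; apply: oppr_inj; rewrite -[RHS]e; ring.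
- by have := sqr_sqrV_gt0 _ z0; lra.
- have {}e : 1 + t ^+ 4 = z ^+ 2 + z ^- 2 by lra.
  (* The overlap is k = -2, where again z^2 = t^2 = 1. *)
  by have [-> t1] := family_intersection _ _ z0 t0 e; rewrite exprVn t1 invr1.
Qed.

Lemma preper_graph4 (k : rat) : no_long_cycle -> k != 0 -> family4 k ->
  has_preper_graph (f k) G4.
Proof.
move=> noper k0 [t [t0 t1 tN1 kt]].
have tV0 : t^-1 != 0 by rewrite invr_eq0.
have t2 : t ^+ 2 != 1 by rewrite sqrf_eq1 negb_or t1.
(* Equality would give t^4 = 1; this keeps the four cycle points distinct. *)
have t2V : t ^+ 2 != t^-1 ^+ 2.
  apply/eqP => h; move/eqP: t2; apply; apply/eqP.
  rewrite -(@pexpr_eq1 _ _ 2) ?sqr_ge0 // expr2 {2}h -exprMn divff // expr1n //.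
have kpos : 0 < t ^+ 2 + t ^- 2 := sqr_sqrV_gt0 _ t0.
have sym (z : rat) : (- z) ^+ 2 + (- z) ^- 2 = z ^+ 2 + z ^- 2 by rewrite sqrrN.
have symV : t^-1 ^+ 2 + t^-1 ^- 2 = t ^+ 2 + t ^- 2.
  by rewrite exprVn invrK addrC.
have no_fam2 z : z != 0 -> 1 + z^-1 ^+ 4 <> t ^+ 2 + t ^- 2.
  move=> z0; have zV0 : z^-1 != 0 by rewrite invr_eq0.
  by move/(family_intersection _ _ t0 zV0) => [/eqP]; rewrite (negbTE t2).
case: kt => kt.
  (* For positive [k] the cycles pair t with 1/t and -t with -1/t. *)
  apply: (@has_preper_graph_intro _ _
    [:: infty; affine 0; affine t; affine t^-1; affine (- t); affine (- t^-1)]) => //.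
  - exact: uniq_pm2.
  - case=> [|[|[|[|[|[|]]]]]] // _; rewrite /= ?f_infty ?f_0 //
      f_inv ?oppr_eq0 ?invrN ?invrK //.
    + by rewrite symV.
    + by rewrite sym.
    + by rewrite sym symV.
  apply: preperiodic_in => // z z0 pz; rewrite !inE !(inj_eq Some_inj) (negbTE z0) /=.
  have z4 : 0 < z ^+ 4 by rewrite exprn_even_gt0.
  have := period2P _ _ k0 z0 (preperiodic_period2 _ _ noper k0 z0 pz).
  case=> e.
  - by case: (no_fam2 z z0); rewrite -kt; symmetry; apply: inv_family2.
  - by rewrite kt in e; have := mulr_gt0 kpos z4; lra.
  - rewrite kt in e; case: (sqr_sqrV_inj _ _ z0 t0 (esym e)) => ->; by rewrite eqxx ?orbT.
  - by have := sqr_sqrV_gt0 _ z0; lra.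
(* For negative [k] the cycles pair t with -1/t and -t with 1/t, whence the other order. *)
apply: (@has_preper_graph_intro _ _
  [:: infty; affine 0; affine t; affine (- t^-1); affine (- t); affine t^-1]) => //.
- by rewrite -{2}(opprK t^-1); apply: uniq_pm2; rewrite ?oppr_eq0 // sqrrN.
- case=> [|[|[|[|[|[|]]]]]] // _; rewrite /= ?f_infty ?f_0 //
    f_opp_inv ?oppr_eq0 ?invrN ?invrK ?opprK //.
  + by rewrite sym symV.
  + by rewrite sym.
  + by rewrite symV.
apply: preperiodic_in => // z z0 pz; rewrite !inE !(inj_eq Some_inj) (negbTE z0) /=.
have z4 : 0 < z ^+ 4 by rewrite exprn_even_gt0.
have := period2P _ _ k0 z0 (preperiodic_period2 _ _ noper k0 z0 pz).
case=> e.
- by rewrite kt in e; have := mulr_gt0 kpos z4; lra.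
- case: (no_fam2 z z0); apply: oppr_inj; rewrite -kt; symmetry; exact: inv_family3.
- by have := sqr_sqrV_gt0 _ z0; lra.
- rewrite kt in e; have {}e := oppr_inj e.
  case: (sqr_sqrV_inj _ _ z0 t0 (esym e)) => ->; by rewrite eqxx ?orbT.
Qed.

(** * Recovering the family from the graph *)

(** Vertex 2 is a loop, and its point is neither infinity nor 0, which the labels give to vertices 0
    and 1. *)
Lemma family2_of_graph (k : rat) : k != 0 -> has_preper_graph (f k) G2 -> family2 k.
Proof.
move=> k0 /has_preper_graph_elim [pts [pts_inj edgeP p0 p1]].
have e2 := edgeP (@Ordinal 4 2 isT) (@Ordinal 4 2 isT) erefl.
case pE : (pts _) e2 => [z|] e2; last first.
  by have /pts_inj := etrans pE (esym (p0 ord0 erefl)).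
apply: (@fixed_family2 k z) => //; apply/eqP => z0.
by rewrite z0 in pE; have /pts_inj := etrans pE (esym (p1 (@Ordinal 4 1 isT) erefl)).
Qed.

(** It serves [G3] and [G4] alike; one 2-cycle does not decide between the families, the number of
    vertices does. *)
Lemma two_cycle_of_graph (k : rat) (s : seq nat) (i j : 'I_(size s)) : k != 0 ->
  (1 < i)%N -> i != j -> nth 0%N s i = j -> nth 0%N s j = i ->
  has_preper_graph (f k) s -> family3 k \/ family4 k.
Proof.
move=> k0 i_gt1 ij si sj /has_preper_graph_elim [pts [pts_inj edgeP p0 p1]].
have s1 : (1 < size s)%N by apply: leq_trans (ltn_ord i); apply: ltnW.
have s0 : (0 < size s)%N by apply: ltnW.
have eij := edgeP _ _ si; have eji := edgeP _ _ sj.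
case pE : (pts i) (eij) => [z|] e2; last first.
  have /pts_inj h := etrans pE (esym (p0 (Ordinal s0) erefl)).
  by rewrite h in i_gt1.
have z0 : z != 0.
  apply/eqP => z0; rewrite z0 in pE.
  by have /pts_inj h := etrans pE (esym (p1 (Ordinal s1) erefl)); rewrite h in i_gt1.
apply: (@two_cycle_family k z) => //; rewrite -[affine z]pE eij; first by rewrite eji.
by move/pts_inj => h; rewrite h eqxx in ij.
Qed.

Theorem theorem7p4 :
  ~ (exists (k : rat) (P : P1Q) (n : nat),
       [/\ k != 0, (3 <= n)%N & has_minimal_period (f k) n P]) ->
  (forall k : rat, k != 0 ->
     [/\ has_preper_graph (f k) G1 <->
           ~ (family2 k \/ family3 k \/ family4 k),
         has_preper_graph (f k) G2 <-> family2 k,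
         has_preper_graph (f k) G3 <-> family3 k &
         has_preper_graph (f k) G4 <-> family4 k]) /\
  (forall s : seq nat, s \in [:: G1; G2; G3; G4] ->
     exists k : rat, k != 0 /\ has_preper_graph (f k) s).
Proof.
move=> H; split=> [k k0|s].
  have g1 := preper_graph1 _ H k0; have g2 := preper_graph2 _ H k0.
  have g3 := preper_graph3 _ H k0; have g4 := preper_graph4 _ H k0.
  split; split=> //.
  - by move=> G [/g2|[/g3|/g4]] /(has_preper_graph_size _ _ _ G).
  - exact: family2_of_graph.
  - move=> G; have [] // := @two_cycle_of_graph k G3
      (@Ordinal 4 2 isT) (@Ordinal 4 3 isT) k0 isT isT erefl erefl G.
    by move/g4 => /(has_preper_graph_size _ _ _ G).
  - move=> G; have [] // := @two_cycle_of_graph k G4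
      (@Ordinal 6 2 isT) (@Ordinal 6 3 isT) k0 isT isT erefl erefl G.
    by move/g3 => /(has_preper_graph_size _ _ _ G).
rewrite !inE => /or4P[] /eqP->.
(* k = 1 is in no family: 1 + t^4 > 1, and t^2 + t^-2 >= 2 because (t - 1/t)^2 >= 0; the other
   values are negative. *)
- exists 1; split=> //; apply: preper_graph1 => // -[|[]] [t [t0]].
  + by have : 0 < t ^+ 4 by [rewrite exprn_even_gt0]; lra.
  + by have : 0 < t ^+ 4 by [rewrite exprn_even_gt0]; lra.
  + move=> _ _; have kpos := sqr_sqrV_gt0 _ t0; case=> e; last lra.
    have := sqr_ge0 (t - t^-1); have -> : (t - t^-1) ^+ 2 = t ^+ 2 + t ^- 2 - 2 by field.
    lra.
- by exists 2; split=> //; apply: preper_graph2 => //; exists 1.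
- by exists (- 2); split=> //; apply: preper_graph3 => //; exists 1.
(* 17/4 = 2^2 + 2^-2, the value at t = 2. *)
- exists (17 / 4); split=> //; apply: preper_graph4 => //; exists 2; split=> //; left.
  by field.
Qed.
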